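(* For odd integers $p \geq 3$ let $f_p(x) = \frac{x^p - x}{p} + x^{(p+1)/2} + 1$. Then, as $p \to \infty$ through the odd integers, \[ M(f_p(x)) \sim \frac{1 + \sqrt{1 + 4/p^2}}{2} \] to all orders in $p$, meaning that for every integer $n$ the difference $M(f_p(x)) - \frac{1 + \sqrt{1 + 4/p^2}}{2}$ is $\mathcal{O}(p^{n})$ as $p \to \infty$. In particular, $\lim_{p \to \infty} M(f_p(x)) = 1$.
   Context: For a polynomial $P(x) = c\prod_{j=1}^d (x - \alpha_j) \in \mathbb{C}[x]$ with $c \neq 0$, its Mahler measure is $M(P(x)) = |c| \prod_{j=1}^d \max\{1, |\alpha_j|\}$. *)

(* Defs.v *)
From HB Require Import structures.
From mathcomp Require Import all_boot all_order all_algebra.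
From mathcomp Require Import all_classical all_reals all_analysis.
From mathcomp Require Import complex.

Set Implicit Arguments.
Unset Strict Implicit.
Unset Printing Implicit Defensive.

Import Order.TTheory GRing.Theory Num.Theory.
Import numFieldNormedType.Exports.

Local Open Scope classical_set_scope.
Local Open Scope ring_scope.

Definition cmod (R : rcfType) (z : R[i]) : R := complex.Re `|z|.

(* The roots of P listed with multiplicity. *)
Definition croots (R : rcfType) (P : {poly R[i]}) : seq R[i] :=
  sval (closed_field_poly_normal P).

Definition mahler (R : rcfType) (P : {poly R[i]}) : R :=
  cmod (lead_coef P) * \prod_(a <- croots P) Num.max 1 (cmod a).

(* The value does not depend on the ordering of the roots chosen in croots. *)
Lemma mahlerE (R : rcfType) (c : R[i]) (s : seq R[i]) : c != 0 ->
  mahler (c *: \prod_(a <- s) ('X - a%:P)) =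
  cmod c * \prod_(a <- s) Num.max 1 (cmod a).
Proof.
move=> c0; set P := c *: _.
have lcP : lead_coef P = c.
  by rewrite lead_coefZ (monicP (monic_prod_XsubC _ _ _)) mulr1.
rewrite /mahler lcP; congr (_ * _); apply: perm_big.
apply: prod_XsubC_eq; apply: (scalerI c0).
by rewrite -/P -{1}lcP /croots; case: closed_field_poly_normal => r /=.
Qed.

Definition fpoly (R : rcfType) (p : nat) : {poly R[i]} :=
  (p%:R)^-1 *: ('X^p - 'X) + 'X^((p + 1) %/ 2) + 1.

Definition odd_infty : set_system nat :=
  within [set p | odd p /\ (3 <= p)%N] \oo.

Global Instance odd_infty_filter : ProperFilter odd_infty.
Proof.
apply: Build_ProperFilter_ex => A [N _ NA].
have le3 : (3 <= N.*2 + 3)%N by rewrite leq_addl.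
have leN : (N <= N.*2 + 3)%N by rewrite -addnn -addnA leq_addr.
exists (N.*2 + 3)%N; apply: NA => //=; split=> //.
by rewrite oddD odd_double.
Qed.

(* Main.v *)
(** Write p = 2q + 1 and g(y) = y + (y^2 - 1) / p, so that f_p(x) = 1 + x g(x^q).
Multiplying over the fibre x^q = y gives 1 - (- g(y))^q y, whose roots are the
q-th powers of the roots of f_p.  On the circles |y| = 2 and |y| = 4 the term
y g(y)^q dominates 1 by a factor (3/2)^q, so comparing means of log-moduli on
these circles compares the roots of f_p with those of y g(y)^q, and the Mahler
measure of the quadratic g is exactly (1 + sqrt (1 + 4 / p^2)) / 2.  As |g| >= 1
for 1 <= |y| <= 4, no q-th power of a root lies in 1 < |y| <= 4, so the two means
differ from the Mahler measure of f_p only through the number of roots in the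
unit disc, which is eliminated between them. *)

Require Import Defs.
From mathcomp Require Import all_boot all_order all_algebra.
From mathcomp Require Import all_classical all_reals all_analysis.
From mathcomp Require Import complex.
From mathcomp Require Import ring lra zify.

Import Order.TTheory GRing.Theory Num.Theory.
Import numFieldNormedType.Exports.

Local Open Scope classical_set_scope.
Local Open Scope ring_scope.

Set Implicit Arguments.
Unset Strict Implicit.
Unset Printing Implicit Defensive.

(** * Real-valued modulus and roots of unity *)

Section Modulus.
Variable R : rcfType.
Implicit Types (x y z : R[i]) (s : R).

Lemma cmodE z : cmod z = Num.sqrt (complex.Re z ^+ 2 + complex.Im z ^+ 2).
Proof. by rewrite /cmod normc_def. Qed.

Lemma cmodC z : (cmod z)%:C%C = `|z|.
Proof. by rewrite cmodE normc_def. Qed.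

Lemma cmod_ge0 z : 0 <= cmod z.
Proof. by rewrite cmodE sqrtr_ge0. Qed.

Lemma sqr_cmod z : cmod z ^+ 2 = complex.Re z ^+ 2 + complex.Im z ^+ 2.
Proof. by rewrite cmodE sqr_sqrtr // addr_ge0 // sqr_ge0. Qed.

Lemma ler_Re_cmod z : complex.Re z <= cmod z.
Proof.
by rewrite cmodE (le_trans (ler_norm _)) // -sqrtr_sqr ler_wsqrtr // lerDl sqr_ge0.
Qed.

Lemma cmodM x y : cmod (x * y) = cmod x * cmod y.
Proof.
by apply: (@complexI R); rewrite rmorphM /= !cmodC normrM.
Qed.

Lemma cmodN x : cmod (- x) = cmod x.
Proof. by rewrite /cmod normrN. Qed.

Lemma cmod1 : cmod (1 : R[i]) = 1.
Proof. by rewrite /cmod normr1. Qed.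

Lemma cmod0 : cmod (0 : R[i]) = 0.
Proof. by rewrite /cmod normr0. Qed.

Lemma cmod_real s : cmod s%:C%C = `|s|.
Proof. by rewrite cmodE /= expr0n addr0 sqrtr_sqr. Qed.

Lemma cmodX x n : cmod (x ^+ n) = cmod x ^+ n.
Proof. by elim: n => [|n IH]; rewrite ?expr0 ?cmod1 // !exprS cmodM IH. Qed.

Lemma cmod_prod (I : Type) (r : seq I) (F : I -> R[i]) :
  cmod (\prod_(i <- r) F i) = \prod_(i <- r) cmod (F i).
Proof. exact: (big_morph _ cmodM cmod1). Qed.

Lemma ler_cmodD x y : cmod (x + y) <= cmod x + cmod y.
Proof. by rewrite -lecR rmorphD /= !cmodC ler_normD. Qed.

Lemma ler_cmodB x y : cmod x - cmod y <= cmod (x - y).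
Proof. by rewrite lerBlDr (le_trans _ (ler_cmodD _ _)) // subrK. Qed.

Lemma cmodBC x y : cmod (x - y) = cmod (y - x).
Proof. by rewrite -cmodN opprB. Qed.

(** The homogeneous form serves two purposes: equally spaced points on a circle, and the fibres of
    [x |-> x ^+ q]. *)
Lemma unity_roots_factor n : (0 < n)%N ->
  exists zs : seq R[i], [/\ size zs = n, {in zs, forall z, z ^+ n = 1} &
    forall x y, \prod_(z <- zs) (x - z * y) = x ^+ n - y ^+ n].
Proof.
move=> n0; have [zs] := closed_field_poly_normal ('X^n - 1 : {poly R[i]}).
have mon : ('X^n - 1 : {poly R[i]}) \is monic by rewrite -polyC1 monicXnsubC.
rewrite (monicP mon) scale1r => Ezs.
have sz : size zs = n.
  have := size_XnsubC (1 : R[i]) n0.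
  by rewrite polyC1 Ezs size_prod_XsubC => -[].
exists zs; split=> // [z zs_z | x y].
  have : root (\prod_(z <- zs) ('X - z%:P)) z by rewrite root_prod_XsubC.
  by rewrite -Ezs rootE !hornerE subr_eq0 => /eqP.
(* The general case divides by [y], so [y = 0] is settled apart. *)
have [-> | y0] := eqVneq y 0.
  under eq_bigr do rewrite mulr0 subr0.
  by rewrite big_const_seq count_predT sz iter_mulr_1 expr0n eqn0Ngt n0 subr0.
have /(congr1 (fun P => P.[x / y])) := Ezs.
rewrite horner_prod !hornerE => E.
transitivity (y ^+ n * ((x / y) ^+ n - 1)); last first.
  by rewrite mulrBr mulr1 expr_div_n mulrCA divff ?mulr1 ?expf_neq0.
rewrite E -sz -[size zs]count_predT -iter_mulr_1 -big_const_seq -big_split /=.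
apply: eq_bigr => z _; rewrite !hornerE mulrBr mulrCA divff // mulr1.
by rewrite [y * z]mulrC.
Qed.

End Modulus.

(** * Comparing geometric means over circles *)

Section MeanComparison.
Variable R : realType.

Lemma geometric_dominates (c x y : R) : 0 <= x < y ->
  exists N, forall n, (N <= n)%N -> c * x ^+ n < y ^+ n.
Proof.
move=> /andP[x0 xy]; have y0 : 0 < y by lra.
have c0 : 0 < `|c| + 1 by rewrite ltr_pwDr.
have xy1 : `|x / y| < 1 by rewrite ger0_norm ?divr_ge0 ?(ltW y0) ?x0 // ltr_pdivrMr ?mul1r.
have /cvgrPdist_lt/(_ (`|c| + 1)^-1) := cvg_expr xy1.
rewrite invr_gt0 => /(_ c0) [N _ NP]; exists N => n Nn.
have /= := NP n Nn; rewrite sub0r normrN ger0_norm ?exprn_ge0 ?divr_ge0 ?(ltW y0) //.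
rewrite expr_div_n ltr_pdivrMr ?exprn_gt0 // ltr_pdivlMl // => /(le_lt_trans _); apply.
by rewrite ler_wpM2r ?exprn_ge0 // (le_trans (ler_norm _)) // lerDl.
Qed.

(** A constant [C] cannot offset a ratio [u / v > 1] raised to the power [n]; bounded losses thus
    vanish in the limit. *)
Lemma ler_of_pow_bound (C u v : R) N : 0 <= v ->
  (forall n, (N <= n)%N -> u ^+ n <= C * v ^+ n) -> u <= v.
Proof.
move=> v0 H; rewrite leNgt; apply/negP => vu.
have [|M MP] := @geometric_dominates C v u; first by rewrite v0.
have := H (maxn N M) (leq_maxl _ _); have := MP (maxn N M) (leq_maxr _ _).
by move=> /lt_le_trans h/h; rewrite ltxx.
Qed.

(** Off the circle, one of [s ^+ n] and [cmod a ^+ n] eventually exceeds twice the other, so the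
    difference keeps at least half of the larger. *)
Lemma max_pow_le_dist (s : R) (a : R[i]) : 0 < s -> cmod a != s ->
  exists N, forall n, (N <= n)%N ->
    Num.max s (cmod a) ^+ n <= 2 * cmod (a ^+ n - s%:C%C ^+ n).
Proof.
move=> s0 neq; have cs : cmod s%:C%C = s by rewrite cmod_real gtr0_norm.
have [lt|le] := ltP s (cmod a).
  have [|N NP] := @geometric_dominates 2 s (cmod a); first by rewrite ltW.
  exists N => n /NP; have := ler_cmodB (a ^+ n) (s%:C%C ^+ n).
  by rewrite !cmodX cs; lra.
have [|N NP] := @geometric_dominates 2 (cmod a) s.
  by rewrite cmod_ge0 lt_neqAle neq.
exists N => n /NP; rewrite cmodBC; have := ler_cmodB (s%:C%C ^+ n) (a ^+ n).
by rewrite !cmodX cs; lra.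
Qed.

Lemma prod_max_pow_le_dist (s : R) (A : seq R[i]) : 0 < s ->
  {in A, forall a, cmod a != s} ->
  exists N, forall n, (N <= n)%N ->
    (\prod_(a <- A) Num.max s (cmod a)) ^+ n
      <= 2 ^+ size A * \prod_(a <- A) cmod (a ^+ n - s%:C%C ^+ n).
Proof.
move=> s0; elim: A => [|a A IH] neq.
  by exists 0%N => n _; rewrite !big_nil expr1n mulr1.
have [|N NP] := IH; first by move=> b bA; apply: neq; rewrite inE bA orbT.
have [|M MP] := @max_pow_le_dist s a s0; first by apply: neq; rewrite mem_head.
exists (maxn N M) => n; rewrite geq_max => /andP[/NP hN /MP hM].
rewrite !big_cons exprMn /= exprS mulrACA ler_pM ?exprn_ge0 //.
  by rewrite le_max ltW.
by apply: prodr_ge0 => b _; rewrite le_max ltW.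
Qed.

Lemma cmod_pow_dist_le (s : R) (b : R[i]) n : 0 < s ->
  cmod (b ^+ n - s%:C%C ^+ n) <= 2 * Num.max s (cmod b) ^+ n.
Proof.
move=> s0; rewrite (le_trans (ler_cmodD _ _)) // cmodN !cmodX cmod_real gtr0_norm //.
rewrite mulr_natl mulr2n; apply: lerD; apply: lerXn2r;
  by rewrite ?nnegrE ?le_max ?lexx ?orbT ?cmod_ge0 // ltW.
Qed.

(* A multiplicative Jensen comparison on the circle of radius s: the product of
   a polynomial over the points z * s, z^n = 1, behaves like the n-th power of
   |lead| * prod max(s, |root|) as n tends to infinity. *)
Lemma prod_max_compare (A B : seq R[i]) (c d s : R) :
  0 <= c -> 0 <= d -> 0 < s -> {in A, forall a, cmod a != s} ->
  (forall y, cmod y = s ->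
     c * \prod_(a <- A) cmod (y - a) <= d * \prod_(b <- B) cmod (y - b)) ->
  c * \prod_(a <- A) Num.max s (cmod a) <= d * \prod_(b <- B) Num.max s (cmod b).
Proof.
move=> c0 d0 s0 neq le_circle; have [N NP] := @prod_max_pow_le_dist s A s0 neq.
have max0 b : 0 <= Num.max s (cmod b) by rewrite le_max ltW.
have over_circle n zs D :
    (forall x y : R[i], \prod_(z <- zs) (x - z * y) = x ^+ n - y ^+ n) ->
    \prod_(z <- zs) \prod_(a <- D) cmod (z * s%:C%C - a)
     = \prod_(a <- D) cmod (a ^+ n - s%:C%C ^+ n).
  move=> Ezs; rewrite exchange_big /=; apply: eq_bigr => a _.
  by rewrite -Ezs cmod_prod; apply: eq_bigr => z _; rewrite cmodBC.
(* Each root of [A] or [B] costs a factor 2; [n >= 1] is required to have [n]-th roots of unity. *)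
apply: (@ler_of_pow_bound (2 ^+ size A * 2 ^+ size B) _ _ (maxn 1 N)).
  by rewrite mulr_ge0 // prodr_ge0.
move=> n; rewrite geq_max => /andP[n0 /NP hA].
have [zs [szs zs1 Ezs]] := unity_roots_factor R n0.
rewrite exprMn (le_trans (ler_wpM2l (exprn_ge0 _ c0) hA)) //.
rewrite mulrCA -mulrA ler_wpM2l ?exprn_ge0 //.
have constE (e : R) : e ^+ n = \prod_(z <- zs) e.
  by rewrite big_const_seq count_predT szs iter_mulr_1.
rewrite (constE c) -(over_circle n zs A Ezs).
rewrite -big_split /=.
apply: (@le_trans _ _ (\prod_(z <- zs) (d * \prod_(b <- B) cmod (z * s%:C%C - b)))).
  rewrite !big_seq; apply: ler_prod => z /zs1 z1; rewrite mulr_ge0 ?prodr_ge0 //=;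
    last by move=> *; exact: cmod_ge0.
  apply: le_circle; rewrite cmodM cmod_real gtr0_norm //.
  suff -> : cmod z = 1 by rewrite mul1r.
  by apply/eqP; rewrite -(@pexpr_eq1 _ _ n) ?cmod_ge0 // -cmodX z1 cmod1.
rewrite big_split /= -constE (over_circle n zs B Ezs) exprMn mulrCA ler_wpM2l ?exprn_ge0 //.
rewrite -prodrXl -[size B]count_predT -(iter_mulr_1 (count _ _)) -big_const_seq -big_split /=.
by apply: ler_prod => b _; rewrite cmod_ge0 cmod_pow_dist_le.
Qed.

End MeanComparison.

(** * Products over the fibres of [x |-> x ^+ q], and the gap in the root moduli *)

Section CircleProduct.
Variable R : rcfType.
Implicit Types (p q : nat) (x y : R[i]) (s : R).

Definition gval p y : R[i] := y + p%:R^-1 * (y ^+ 2 - 1).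

Lemma horner_fpoly q x :
  (fpoly R q.*2.+1).[x] = 1 + x * gval q.*2.+1 (x ^+ q).
Proof.
rewrite /fpoly /gval; have -> : ((q.*2.+1 + 1) %/ 2 = q.+1)%N by lia.
rewrite !hornerE !exprS -muln2 exprM; ring.
Qed.

Lemma lead_coef_fpoly q : (0 < q)%N ->
  lead_coef (fpoly R q.*2.+1) = (q.*2.+1)%:R^-1.
Proof.
move=> q0; rewrite /fpoly; have -> : ((q.*2.+1 + 1) %/ 2 = q.+1)%N by lia.
have p0 : ((q.*2.+1)%:R : R[i])^-1 != 0 by rewrite invr_eq0 pnatr_eq0.
rewrite scalerBr -!addrA lead_coefDl ?lead_coefZ ?lead_coefXn ?mulr1 //.
rewrite size_scale // size_polyXn ltnS.
rewrite (leq_trans (size_polyD _ _)) // geq_max; apply/andP; split.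
  by rewrite size_polyN size_scale // size_polyX; lia.
rewrite (leq_trans (size_polyD _ _)) // geq_max size_polyXn size_poly1; lia.
Qed.

Lemma horner_fpoly_croots q x : (0 < q)%N ->
  (fpoly R q.*2.+1).[x] =
  (q.*2.+1)%:R^-1 * \prod_(a <- croots (fpoly R q.*2.+1)) (x - a).
Proof.
move=> q0; rewrite /croots; case: closed_field_poly_normal => r /= Er.
rewrite {1}Er hornerZ lead_coef_fpoly // horner_prod; congr (_ * _).
by apply: eq_bigr => a _; rewrite !hornerE.
Qed.

Lemma cmod_natV p : cmod (p%:R^-1 : R[i]) = p%:R^-1.
Proof.
have -> : (p%:R^-1 : R[i]) = (p%:R^-1)%:C%C by rewrite fmorphV rmorph_nat.
by rewrite cmod_real ger0_norm // invr_ge0.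
Qed.

(* Multiplying 1 + x g(x^q) over x in a fibre of x |-> x^q. *)
Lemma prod_croots_fpoly q y : (0 < q)%N ->
  ((q.*2.+1)%:R^-1) ^+ q *
    \prod_(a <- croots (fpoly R q.*2.+1)) cmod (y - a ^+ q)
  = cmod (1 - (- gval q.*2.+1 y) ^+ q * y).
Proof.
move=> q0; have [zs [szs zs1 Ezs]] := unity_roots_factor R q0.
(* One point of the fibre; the others are [z * x] with [z ^+ q = 1]. *)
pose x : R[i] := q.-root y; have xq : x ^+ q = y by rewrite rootCK.
transitivity (cmod (\prod_(z <- zs) (fpoly R q.*2.+1).[z * x])).
  rewrite cmod_prod; under [RHS]eq_bigr do rewrite horner_fpoly_croots // cmodM cmod_natV.
  rewrite big_split /= big_const_seq count_predT szs iter_mulr_1; congr (_ * _).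
  under [RHS]eq_bigr do rewrite cmod_prod.
  rewrite exchange_big /=; apply: eq_bigr => a _.
  rewrite -xq cmodBC -Ezs cmod_prod; apply: eq_bigr => z _; exact: cmodBC.
(* On the fibre the factor becomes [1 - z * (x * - g(y))], so the roots-of-unity identity applies
   again. *)
rewrite big_seq; under eq_bigr => z /zs1 z1.
  rewrite horner_fpoly exprMn z1 mul1r xq -[z * x * _]opprK -mulrN -mulrA.
  over.
rewrite -big_seq Ezs expr1n exprMn xq; congr (cmod (_ - _)); exact: mulrC.
Qed.

Lemma cmod_gval_ge p y :
  cmod y - (cmod y ^+ 2 + 1) / p%:R <= cmod (gval p y).
Proof.
have -> : gval p y = y - p%:R^-1 * (1 - y ^+ 2) by rewrite /gval; ring.
apply: le_trans (ler_cmodB _ _).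
rewrite lerD2l lerN2 cmodM cmod_natV mulrC ler_wpM2r ?invr_ge0 //.
by rewrite (le_trans (ler_cmodD _ _)) // cmodN cmod1 cmodX addrC.
Qed.

(** With S = |y| and k = 1/p, the real part of g(y) times the conjugate of y is S^2 + k (S^2 - 1) Re
    y >= S^2 - k (S^2 - 1) S. This is at least S because k (S + 1) <= 1. *)
Lemma cmod_gval_ge1 p y : (5 <= p)%N -> 1 <= cmod y <= 4 -> 1 <= cmod (gval p y).
Proof.
move=> p5 /andP[y1 y4].
have : complex.Re (gval p y * y^*%C) <= cmod (gval p y) * cmod y.
  rewrite (le_trans (ler_Re_cmod _)) // cmodM.
  by have -> : cmod y^*%C = cmod y by rewrite /cmod normcJ.
have : - cmod y <= complex.Re y.
  by have := ler_Re_cmod (- y); rewrite cmodN raddfN /=; lra.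
have := sqr_cmod y.
have e : (p%:R^-1 : R[i]) = (p%:R^-1)%:C%C by rewrite fmorphV rmorph_nat.
have : 0 < (p%:R^-1 : R) <= 5^-1.
  by rewrite invr_gt0 ltr0n lef_pV2 ?posrE ?ltr0n ?ler_nat; lia.
rewrite /gval {}e; set S := cmod y in y1 y4 *; set G := cmod _.
move: (p%:R^-1) => k /andP[k0 k5].
case: y S y1 y4 G => u v S y1 y4 G /= S2 uS.
have -> : (u + (k * (u * u - v * v - 1) - 0 * (u * v + v * u - 0))) * u -
   (v + (k * (u * v + v * u - 0) + 0 * (u * u - v * v - 1))) * - v =
   S ^+ 2 + k * (S ^+ 2 - 1) * u by rewrite S2; ring.
move=> H; rewrite -(@ler_pM2r _ S); last lra.
apply: le_trans H; rewrite mul1r.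
have h1 : 0 <= k * (S ^+ 2 - 1) * (u + S).
  by rewrite mulr_ge0 //; [rewrite mulr_ge0; nra|lra].
have h2 : 0 <= S * (S - 1) * (1 - k * (S + 1)).
  by rewrite mulr_ge0 //; [rewrite mulr_ge0; lra|nra].
lra.
Qed.

(** A root satisfies |a| |g(a^q)| = 1, which is impossible when |a| > 1 and |g(a^q)| >= 1. *)
Lemma croots_fpoly_gap q a : (2 <= q)%N -> a \in croots (fpoly R q.*2.+1) ->
  1 < cmod a ^+ q -> 4 < cmod a ^+ q.
Proof.
move=> q2 ar a1; rewrite ltNge; apply/negP => a4; have q0 : (0 < q)%N by apply: leq_trans q2.
have : (fpoly R q.*2.+1).[a] = 0.
  rewrite horner_fpoly_croots //; apply/eqP; rewrite mulf_eq0; apply/orP; right.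
  rewrite prodf_seq_eq0; apply/hasP; exists a => //=; exact/eqP/subrr.
rewrite horner_fpoly => /(canRL (addKr _)) /(congr1 (@cmod R)).
rewrite cmodM addr0 cmodN cmod1 => E.
have g1 : 1 <= cmod (gval q.*2.+1 (a ^+ q)).
  by apply: cmod_gval_ge1; [lia | rewrite cmodX a4 ltW].
have : 1 < cmod a by move: a1; rewrite expr_gt1 ?cmod_ge0.
nra.
Qed.

(** Roots outside the unit disc have |a|^q > 4 >= s and contribute as in the Mahler measure; each
    other root contributes [s]. Hence [n] counts the latter and is the same for all [s]. *)
Lemma prod_max_croots q : (2 <= q)%N ->
  exists n, forall s, 1 <= s <= 4 ->
  ((q.*2.+1)%:R^-1) ^+ q *
    \prod_(a <- croots (fpoly R q.*2.+1)) Num.max s (cmod (a ^+ q))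
  = s ^+ n * mahler (fpoly R q.*2.+1) ^+ q.
Proof.
move=> q2; have q0 : (0 < q)%N by apply: leq_trans q2.
set r := croots _; exists (count (fun a => cmod a <= 1) r) => s /andP[s1 s4].
rewrite /mahler lead_coef_fpoly // cmod_natV exprMn mulrCA; congr (_ * _).
rewrite -iter_mulr_1 -big_const_seq [in RHS]big_mkcond /= -prodrXl -big_split /=.
rewrite !big_seq; apply: eq_bigr => a ar; rewrite cmodX.
have [le1|gt1] := leP (cmod a) 1.
  rewrite expr1n mulr1 max_l // (le_trans _ s1) // exprn_ile1 ?cmod_ge0 //.
rewrite mul1r max_r // (le_trans s4) // ltW // croots_fpoly_gap //.
by rewrite expr_gt1 ?cmod_ge0.
Qed.

End CircleProduct.

(** * The Mahler measure of g, and estimates on the circles of radius 2 and 4 *)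

Section Estimate.
Variable R : realType.
Implicit Types (p q : nat) (s : R).

Definition limit_value p : R := (1 + Num.sqrt (1 + 4 / p%:R ^+ 2)) / 2.

(** Hence, for [p > 0], [- (p * limit_value p)] and [p * (limit_value p - 1)] have sum -p and
    product -1: they are the roots of p g(y) = y^2 + p y - 1. *)
Lemma limit_value_root p : limit_value p ^+ 2 - limit_value p = (p%:R ^+ 2)^-1.
Proof.
rewrite /limit_value; set k := (p%:R ^+ 2)^-1.
have k0 : 0 <= k by rewrite invr_ge0 sqr_ge0.
have : Num.sqrt (1 + 4 * k) ^+ 2 = 1 + 4 * k by rewrite sqr_sqrtr //; lra.
move: (Num.sqrt _) => t; nra.
Qed.

Lemma limit_value_bounds p :
  1 <= limit_value p <= 1 + (p%:R ^+ 2)^-1.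
Proof.
have := limit_value_root p; have : 0 <= (p%:R ^+ 2 : R)^-1 by rewrite invr_ge0 sqr_ge0.
have : 0 <= Num.sqrt (1 + 4 / p%:R ^+ 2 : R) by exact: sqrtr_ge0.
rewrite /limit_value; set k := (p%:R ^+ 2)^-1; move: (Num.sqrt _) => t; nra.
Qed.

(** One root of g has modulus at least p and the other lies in the unit disc. *)
Lemma limit_value_scaled_bounds n :
  n.+1%:R <= n.+1%:R * limit_value n.+1 /\
  0 <= n.+1%:R * (limit_value n.+1 - 1) <= 1.
Proof.
have /andP[A1 A2] := limit_value_bounds n.+1.
have p1 : 1 <= n.+1%:R :> R by rewrite ler1n.
have k : (n.+1%:R ^+ 2)^-1 * n.+1%:R = n.+1%:R^-1 :> R by field; lra.
have k1 : n.+1%:R^-1 <= 1 :> R by rewrite invf_le1 //; lra.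
split; first by rewrite ler_peMr.
apply/andP; split; first by rewrite mulr_ge0 ?subr_ge0.
by apply: le_trans k1; rewrite -k mulrC ler_wpM2r // lerBlDl.
Qed.

(* The roots of y g(y)^q, with multiplicity. *)
Definition gpow_roots q : seq R[i] :=
  let p := q.*2.+1 in
  0 :: nseq q (- (p%:R * limit_value p))%:C%C
    ++ nseq q (p%:R * (limit_value p - 1))%:C%C.

Lemma prod_gpow_roots (F : R[i] -> R) q :
  \prod_(b <- gpow_roots q) F b =
  F 0 * (F (- ((q.*2.+1)%:R * limit_value q.*2.+1))%:C%C ^+ q
       * F ((q.*2.+1)%:R * (limit_value q.*2.+1 - 1))%:C%C ^+ q).
Proof. by rewrite /gpow_roots big_cons big_cat /= !big_nseq !iter_mulr_1. Qed.

Lemma cmod_gpow q (y : R[i]) :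
  cmod ((- gval q.*2.+1 y) ^+ q * y) =
  ((q.*2.+1)%:R^-1) ^+ q * \prod_(b <- gpow_roots q) cmod (y - b).
Proof.
have EA := limit_value_root q.*2.+1; rewrite prod_gpow_roots subr0 cmodM cmodX cmodN.
set p := q.*2.+1 in EA *; move: (limit_value p) EA => A EA.
have p0 : (p%:R : R) != 0 by rewrite pnatr_eq0.
have p0' : (p%:R : R[i]) != 0 by rewrite pnatr_eq0.
have EAC : (A%:C%C ^+ 2 - A%:C%C) * p%:R ^+ 2 = 1 :> R[i].
  by rewrite -rmorphXn -rmorphB /= EA fmorphV rmorphXn rmorph_nat mulVf // expf_neq0.
have -> : gval p y =
    p%:R^-1 * ((y - (- (p%:R * A))%:C%C) * (y - (p%:R * (A - 1))%:C%C)).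
  rewrite rmorphN !rmorphM rmorphB rmorph1 rmorph_nat.
  transitivity (y + p%:R^-1 * (y ^+ 2 - (A%:C%C ^+ 2 - A%:C%C) * p%:R ^+ 2)).
    by rewrite EAC.
  by field.
rewrite !cmodM cmod_natV !exprMn; ring.
Qed.

(** The root 0 and the [q] copies of the small root give [s ^+ q.+1]; the powers of p from the large
    root cancel the leading coefficient. *)
Lemma prod_max_gpow_roots q s : (2 <= q)%N -> 1 <= s <= 4 ->
  ((q.*2.+1)%:R^-1) ^+ q * \prod_(b <- gpow_roots q) Num.max s (cmod b)
  = s ^+ q.+1 * limit_value q.*2.+1 ^+ q.
Proof.
move=> q2 /andP[s1 s4]; rewrite prod_gpow_roots cmod0 !cmod_real.
have [] := limit_value_scaled_bounds q.*2.
set p := q.*2.+1; move: (limit_value p) => A pA /andP[pA0 pA1].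
have p5 : 5 <= p%:R :> R by rewrite ler_nat /p; lia.
rewrite normrN !ger0_norm //; last lra.
rewrite (max_l (_ : 0 <= s)); last lra.
rewrite (max_r (_ : s <= p%:R * A)); last lra.
rewrite (max_l (_ : p%:R * (A - 1) <= s)); last lra.
have -> : p%:R^-1 ^+ q * (s * ((p%:R * A) ^+ q * s ^+ q)) =
   (p%:R^-1 * p%:R) ^+ q * (s ^+ q.+1 * A ^+ q) by rewrite !exprMn exprS; ring.
by rewrite mulVf ?expr1n ?mul1r //; lra.
Qed.

(** Since p >= 11, |g(y)| >= s - (s^2 + 1)/p is at least 17/11 for s = 2 and 27/11 for s = 4, both
    above 3/2. *)
Lemma gpow_dominates q s (y : R[i]) : (5 <= q)%N -> s = 2 \/ s = 4 -> cmod y = s ->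
  1 <= (2 / 3) ^+ q * cmod ((- gval q.*2.+1 y) ^+ q * y).
Proof.
move=> q5 s24 ys; rewrite cmodM cmodX cmodN ys.
have := cmod_gval_ge q.*2.+1 y; rewrite ys.
have : 0 < ((q.*2.+1)%:R^-1 : R) <= 11^-1.
  by rewrite invr_gt0 ltr0n lef_pV2 ?posrE ?ltr0n ?ler_nat; lia.
move: (_^-1) (cmod (gval _ _)) => k g /andP[k0 k11] kg.
have g32 : 3 / 2 <= g by case: s24 kg => ->; lra.
have s1 : 1 <= s by case: s24 => ->; lra.
rewrite mulrA -exprMn mulr_ege1 // exprn_ege1 //; lra.
Qed.

(** With w = (- g(y))^q y and d = (2/3)^q, domination puts |1 - w| between (1 - d)|w| and (1 + d)|w|
    on the circle. Taking [n] as a parameter lets both circles share it. *)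
Lemma mahler_mean_bounds q s n (M := mahler (fpoly R q.*2.+1))
    (A := limit_value q.*2.+1) : (5 <= q)%N -> s = 2 \/ s = 4 ->
  ((q.*2.+1)%:R^-1) ^+ q *
    \prod_(a <- croots (fpoly R q.*2.+1)) Num.max s (cmod (a ^+ q))
  = s ^+ n * M ^+ q ->
  (1 - (2 / 3) ^+ q) * (s ^+ q.+1 * A ^+ q) <= s ^+ n * M ^+ q
     <= (1 + (2 / 3) ^+ q) * (s ^+ q.+1 * A ^+ q).
Proof.
move=> q5 s24 En; set d := _ ^+ q.
have q2 : (2 <= q)%N by apply: leq_trans q5.
have q0 : (0 < q)%N by apply: leq_trans q5.
have s0 : 1 < s <= 4 by case: s24 => ->; lra.
have s1 : 1 <= s <= 4 by lra.
have d0 : 0 <= d by rewrite exprn_ge0 //; lra.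
have d1 : d <= 1 by rewrite exprn_ile1 //; lra.
have k0 : 0 <= ((q.*2.+1)%:R^-1 : R) ^+ q by rewrite exprn_ge0 // invr_ge0.
have bound y (w := (- gval q.*2.+1 y) ^+ q * y) : cmod y = s ->
    (1 - d) * cmod w <= cmod (1 - w) <= (1 + d) * cmod w.
  move=> /(gpow_dominates q5 s24); rewrite -/w -/d => dw.
  have := ler_cmodB w 1; have := ler_cmodD 1 (- w); rewrite cmodBC cmodN cmod1; lra.
pose r := [seq a ^+ q | a <- croots (fpoly R q.*2.+1)].
have rE (F : R[i] -> R) :
    \prod_(a <- croots (fpoly R q.*2.+1)) F (a ^+ q) = \prod_(b <- r) F b.
  by rewrite big_map.
rewrite -(prod_max_gpow_roots q2 s1) -En (rE (fun b => Num.max s (cmod b))) !mulrA.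
have pE y := prod_croots_fpoly y q0.
apply/andP; split; apply: prod_max_compare;
  rewrite ?mulr_ge0 //; try lra.
(* The smaller side must have no root on the circle: here the moduli are 0, at least 11, or at most
   1. *)
- have [pA /andP[pA0 pA1]] := limit_value_scaled_bounds q.*2.
  have p11 : 11 <= (q.*2.+1)%:R :> R by rewrite ler_nat; lia.
  move=> b; rewrite inE mem_cat !mem_nseq => /or3P[/eqP->|/andP[_ /eqP->]|/andP[_ /eqP->]].
  + by rewrite cmod0; lra.
  + rewrite cmod_real normrN ger0_norm ?gt_eqF //; lra.
  + rewrite cmod_real ger0_norm ?lt_eqF //; lra.
- move=> y ys; rewrite -mulrA -cmod_gpow -(rE (fun b => cmod (y - b))) pE.
  by have /andP[] := bound y ys.
(* The gap excludes all moduli in (1, 4], hence [s]. *)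
- move=> _ /mapP[a ar ->]; rewrite cmodX; have := croots_fpoly_gap q2 ar.
  by have [le1|gt1] := leP (cmod a ^+ q) 1; [lra | move=> /(_ isT); lra].
- move=> y ys; rewrite -mulrA -cmod_gpow -(rE (fun b => cmod (y - b))) pE.
  by have /andP[] := bound y ys.
Qed.

Lemma mahler_ge0 (P : {poly R[i]}) : 0 <= mahler P.
Proof.
by rewrite mulr_ge0 ?cmod_ge0 // prodr_ge0 // => a _; rewrite le_max ler01.
Qed.

(* The unknown number n of roots in the unit disc is eliminated between s = 2
   and s = 4, since 4 = 2 ^ 2; this replaces an appeal to Rouche's theorem. *)
Lemma mahler_pow_bounds q (M := mahler (fpoly R q.*2.+1))
    (A := limit_value q.*2.+1) : (5 <= q)%N ->
  (1 - 4 * (2 / 3) ^+ q) * A ^+ q <= M ^+ q <= (1 + 4 * (2 / 3) ^+ q) * A ^+ q.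
Proof.
move=> q5; have [|n En] := @prod_max_croots R q; first exact: leq_trans q5.
have /andP[] := mahler_mean_bounds q5 (or_introl erefl) (En 2 ltac:(lra)).
have /andP[] := mahler_mean_bounds q5 (or_intror erefl) (En 4 ltac:(lra)).
(* The bound 1/5 is what (1 + d)^2 <= (1 + 4 d)(1 - d) requires, the difference being d (1 - 5
   d). *)
have d5 : (2 / 3) ^+ q <= 5^-1 :> R.
  have -> : q = (5 + (q - 5))%N by rewrite subnKC.
  rewrite exprD (@le_trans _ _ ((2 / 3) ^+ 5)) //; last by rewrite !exprS; lra.
  by rewrite ler_piMr ?exprn_ge0 ?exprn_ile1 //; lra.
have d0 : 0 <= (2 / 3) ^+ q :> R by rewrite exprn_ge0 //; lra.
have A0 : 0 < A ^+ q.
  by rewrite exprn_gt0 //; have := limit_value_bounds q.*2.+1; rewrite -/A; lra.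
have W0 : 0 <= M ^+ q by rewrite exprn_ge0 // mahler_ge0.
have four m : 4 ^+ m = 2 ^+ m * 2 ^+ m :> R by rewrite -exprMn; congr (_ ^+ _); lra.
rewrite !four -/M -/A.
have a0 : 0 < 2 ^+ n :> R by rewrite exprn_gt0.
have b0 : 0 < 2 ^+ q.+1 :> R by rewrite exprn_gt0.
move: (2 ^+ n) (2 ^+ q.+1) a0 b0 (A ^+ q) (M ^+ q) A0 W0 => a b a0 b0 V W V0 W0.
move: ((2 / 3) ^+ q) d0 d5 => d d0 d5 X2l X2u X1l X1u.
have X2 : 0 < a * a * W by apply: lt_le_trans X2l; rewrite !mulr_gt0 //; lra.
(* Squaring the bounds at s = 2 and dividing by those at s = 4 cancels [a] and [b]: (1 - d)^2/(1 +
   d) <= W/V <= (1 + d)^2/(1 - d). *)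
have up : (a * W) * (a * W) <= ((1 + d) * (b * V)) * ((1 + d) * (b * V)).
  by rewrite ler_pM // mulr_ge0 // ltW.
have lo : ((1 - d) * (b * V)) * ((1 - d) * (b * V)) <= (a * W) * (a * W).
  by rewrite ler_pM // mulr_ge0 ?mulr_ge0 // ?ltW //; lra.
apply/andP; split.
  rewrite -(ler_pM2l X2).
  have e1 : 0 <= ((1 + d) * (b * b * V) - a * a * W) * ((1 - d) ^+ 2 * V).
    by rewrite mulr_ge0 ?mulr_ge0 ?sqr_ge0 ?(ltW V0) //; lra.
  have e2 : 0 <= (1 + d) * (a * a * W * W - ((1 - d) ^+ 2) * V * (b * b * V)).
    by rewrite mulr_ge0 //; lra.
  have e3 : 0 <= a * a * W * V * ((1 - d) ^+ 2 - (1 - 4 * d) * (1 + d)).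
    by rewrite mulr_ge0 //; [rewrite mulr_ge0 // ltW | nra].
  rewrite -(@ler_pM2l _ (1 + d)); lra.
rewrite -(ler_pM2l X2).
have e1 : 0 <= (a * a * W - (1 - d) * (b * b * V)) * ((1 + d) ^+ 2 * V).
  by rewrite mulr_ge0 ?mulr_ge0 ?sqr_ge0 ?(ltW V0) //; lra.
have e2 : 0 <= (1 - d) * (((1 + d) ^+ 2) * V * (b * b * V) - a * a * W * W).
  by rewrite mulr_ge0 //; lra.
have e3 : 0 <= a * a * W * V * ((1 + 4 * d) * (1 - d) - (1 + d) ^+ 2).
  by rewrite mulr_ge0 //; [rewrite mulr_ge0 // ltW | nra].
rewrite -(@ler_pM2l _ (1 - d)); lra.
Qed.

(** The [q]-th root is taken via 1 + 4 d <= (1 + 4 d)^q and, if 1 - 4 d >= 0, (1 - 4 d)^q <= 1 - 4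
    d; the 8 is 4 times the bound 2 on [limit_value]. *)
Lemma mahler_fpoly_close q : (5 <= q)%N ->
  `|mahler (fpoly R q.*2.+1) - limit_value q.*2.+1| <= 8 * (2 / 3) ^+ q.
Proof.
move=> q5; have := mahler_pow_bounds q5; have := mahler_ge0 (fpoly R q.*2.+1).
have := limit_value_bounds q.*2.+1.
have k1 : ((q.*2.+1)%:R ^+ 2 : R)^-1 <= 1.
  by rewrite -exprVn exprn_ile1 ?invr_ge0 ?invf_le1 ?ler1n ?ltr0n.
move: (limit_value _) (mahler _) => A M /andP[A1 A2] M0 /andP[lo up].
have q0 : (0 < q)%N by apply: leq_trans q5.
have d0 : 0 <= (2 / 3) ^+ q :> R by rewrite exprn_ge0 //; lra.
move: ((2 / 3) ^+ q) d0 lo up => d d0 lo up.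
have U : M <= (1 + 4 * d) * A.
  rewrite -(ler_pXn2r q0) ?nnegrE ?mulr_ge0 //; try lra.
  rewrite (le_trans up) // exprMn ler_wpM2r ?exprn_ge0 //; first lra.
  by rewrite ler_eXnr //; lra.
have L : (1 - 4 * d) * A <= M.
  have [neg|pos] := ltP (1 - 4 * d) 0; first by nra.
  rewrite -(ler_pXn2r q0) ?nnegrE ?mulr_ge0 //; try lra.
  rewrite (le_trans _ lo) // exprMn ler_wpM2r ?exprn_ge0 //; first lra.
  by rewrite ler_iXnr //; lra.
have dA : d * A <= d * (1 + 1) by rewrite ler_wpM2l // (le_trans A2) // lerD2l.
rewrite ler_norml; lra.
Qed.

(** * Exponential decay against powers of p, and the conclusion *)

Lemma bernoulli_half t : 1 + t%:R / 2 <= (3 / 2) ^+ t :> R.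
Proof.
elim: t => [|t IH]; first by rewrite expr0; lra.
rewrite exprS -natr1; have : 0 <= t%:R :> R by []; nra.
Qed.

(** For m > 0 and t = floor(q/m), (3/2)^q >= (1 + t/2)^m, while 2 q + 1 <= 2 m (t + 1) + 1 <= (4 m +
    1)(1 + t/2). *)
Lemma pow_le_geometric m q :
  (q.*2.+1)%:R ^+ m <= (4 * m).+1%:R ^+ m * (3 / 2) ^+ q :> R.
Proof.
have [->|m0] := posnP m; first by rewrite mul1r exprn_ege1 //; lra.
set t := (q %/ m)%N.
have le1 : (3 / 2) ^+ t ^+ m <= (3 / 2) ^+ q :> R.
  by rewrite -exprM ler_weXn2l ?leq_divM //; lra.
rewrite (le_trans _ (ler_wpM2l _ le1)) ?exprn_ge0 // -exprMn.
rewrite lerXn2r ?nnegrE // ?mulr_ge0 ?exprn_ge0 //; try lra.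
rewrite (le_trans _ (ler_wpM2l _ (bernoulli_half t))) //.
have : (q.*2.+1 <= 2 * m * t.+1 + 1)%N.
  by have := ltn_ceil q m0; rewrite -/t; nia.
rewrite -(ler_nat R) => /le_trans; apply.
have -> : (2 * m * t.+1 + 1)%:R = 2 * m%:R * (t%:R + 1) + 1 :> R.
  by rewrite natrD !natrM natr1.
have -> : (4 * m).+1%:R = 4 * m%:R + 1 :> R by rewrite -natr1 natrM.
have t0 : 0 <= t%:R :> R by []; have m0' : 0 <= m%:R :> R by [].
nra.
Qed.

Lemma mahler_fpoly_close_pow m p : odd p -> (11 <= p)%N ->
  `|mahler (fpoly R p) - limit_value p| <= 8 * (4 * m).+1%:R ^+ m / p%:R ^+ m.
Proof.
move=> op p11; have pE : p = p./2.*2.+1 by rewrite -[LHS]odd_double_half op.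
have q5 : (5 <= p./2)%N by lia.
rewrite {1 2}pE (le_trans (mahler_fpoly_close q5)) // -mulrA ler_wpM2l //.
rewrite ler_pdivlMr; last by rewrite exprn_gt0 // ltr0n; lia.
rewrite {2}pE (le_trans (ler_wpM2l _ (pow_le_geometric m _))) ?exprn_ge0 //; try lra.
rewrite mulrCA -exprMn (_ : 2 / 3 * (3 / 2) = 1); last by lra.
by rewrite expr1n mulr1.
Qed.

(** Here 41 = 8 * 5 + 1: the case m = 1 of the previous bound, plus [limit_value p - 1] <= 1/p^2 <=
    1/p. *)
Lemma mahler_fpoly_cvg_rate p : odd p -> (11 <= p)%N ->
  `|mahler (fpoly R p) - 1| <= 41 / p%:R.
Proof.
move=> op p11; have := mahler_fpoly_close_pow 1 op p11; rewrite !expr1.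
have := limit_value_bounds p; move: (limit_value p) (mahler _) => A M.
have : (p%:R ^+ 2)^-1 <= p%:R^-1 :> R.
  rewrite lef_pV2 ?posrE ?exprn_gt0 ?ltr0n; try lia.
  by rewrite ler_eXnr // ler1n; lia.
move: (_ ^-1) (p%:R^-1) => k l kl /andP[A1 A2]; rewrite !ler_norml; lra.
Qed.

End Estimate.

Theorem theorem2 (R : realType) :
  (forall n : int,
     (fun p : nat => mahler (fpoly R p)
                     - (1 + Num.sqrt (1 + 4 / p%:R ^+ 2)) / 2)
     =O_odd_infty (fun p : nat => (p%:R : R) ^ n))
  /\ mahler (fpoly R p) @[p --> odd_infty] --> (1 : R).
Proof.
split=> [n|].
  (* It suffices to beat one negative power of p: m = 0 if n >= 0, and m = -n otherwise. *)
  have [m mP] : exists m, forall p, (0 < p)%N -> (p%:R ^+ m)^-1 <= `|p%:R ^ n| :> R.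
    case: n => m; [exists 0%N | exists m.+1] => p p0.
      by rewrite expr0 invr1 ger0_norm ?exprz_ge0 // exprn_ege1 // ler1n.
    by rewrite NegzE exprnN ger0_norm ?invr_ge0 ?exprn_ge0.
  apply/eqO_exP; exists (8 * (4 * m).+1%:R ^+ m).
    by rewrite mulr_gt0 // exprn_gt0.
  exists 11%N => // p /= p11 [op _].
  rewrite (le_trans (mahler_fpoly_close_pow R m op p11)) // ler_wpM2l //.
  by apply: mP; apply: leq_trans p11.
apply/cvgrPdist_le => e e0.
exists (maxn 11 (Num.bound (41 / e))) => // p /=.
rewrite geq_max => /andP[p11 pe] [op _].
rewrite distrC (le_trans (mahler_fpoly_cvg_rate R op p11)) //.
have p0 : 0 < p%:R :> R by rewrite ltr0n; apply: leq_trans p11.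
rewrite ler_pdivrMr // mulrC -ler_pdivrMr //.
have e41 : 0 <= 41 / e by rewrite divr_ge0 // ltW.
by rewrite (le_trans (ltW (archi_boundP e41))) // ler_nat.
Qed.
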